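(* Let $I_{\mathcal{L}}=(f_1,\ldots,f_s)$ be a lattice ideal, where $f_1,\ldots,f_s$ is an $R$-sequence (regular sequence) of binomials such that the $\mathcal{A}$-degrees $\mathbf{b}_i=\deg_{\mathcal{A}}(f_i)$ are pairwise incomparable (for $i\ne j$ neither $\mathbf{b}_i\ge\mathbf{b}_j$ nor $\mathbf{b}_j\ge\mathbf{b}_i$). Let $(\mathbf{K}_\bullet,\phi)$ be the Koszul complex on $f_1,\dots,f_s$ and let $\mathbf{B}$ be the canonical system of bases of $\mathbf{K}_\bullet$. Then $(\mathbf{K}_\bullet,\phi,\mathbf{B})$ is an indispensable complex of $R/I_{\mathcal{L}}$.
   Context: Setting. Let $\mathcal{L}\subset\mathbb{Z}^n$ be a lattice (subgroup) with $\mathcal{L}\cap\mathbb{N}^n=\{\mathbf{0}\}$, and let $\mathcal{A}$ be the subsemigroup (containing $0$) of $\mathbb{Z}^n/\mathcal{L}$ generated by $\mathbf{a}_i=\mathbf{e}_i+\mathcal{L}$, $1\le i\le n$, where $\mathbf e_1,\dots,\mathbf e_n$ is the canonical basis of $\mathbb{Z}^n$. $\mathcal{A}$ is partially ordered by $\mathbf{c}\ge\mathbf{d}$ iff $\mathbf{c}=\mathbf{d}+\mathbf{e}$ for some $\mathbf{e}\in\mathcal{A}$. Let $\Bbbk$ be a field and $R=\Bbbk[x_1,\dots,x_n]$, multigraded by $\mathcal{A}$ via $\deg_{\mathcal{A}}(\mathbf{x}^{\mathbf{v}})=v_1\mathbf{a}_1+\cdots+v_n\mathbf{a}_n$. The lattice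 ideal $I_{\mathcal{L}}$ is generated by all binomials $\mathbf{x}^{\mathbf{u}_+}-\mathbf{x}^{\mathbf{u}_-}$ with $\mathbf{u}_+,\mathbf{u}_-\in\mathbb{N}^n$ and $\mathbf{u}_+-\mathbf{u}_-\in\mathcal{L}$; such binomials are $\mathcal{A}$-homogeneous. Resolutions and bases. Complexes are $\mathcal{A}$-homogeneous: finite rank $\mathcal{A}$-graded free $R$-modules with degree-preserving maps. A minimal free resolution of $R/I$ is an exact complex $0\to G_p\xrightarrow{\theta_p}\cdots\to G_1\xrightarrow{\theta_1}G_0=R\xrightarrow{\theta_0}R/I\to0$ of this kind with $\theta_i(G_i)\subset(x_1,\dots,x_n)G_{i-1}$ for $i\ge1$. A based complex $(\mathbf{G}_\bullet,\theta,\mathbf{C})$ is an $\mathcal{A}$-homogeneous complex together with a system of bases $\mathbf{C}=(C_i)$, $C_i$ an $\mathcal{A}$-homogeneous basis of $G_i$. A complex homomorphism $\omega$ from $(\mathbf{F}_\bullet,\phi,\mathbf{B})$ to $(\mathbf{G}_\bullet,\theta,\mathbf{C})$ is a based homomorphism if for each $i$ and each $E\in B_i$ there are $H\in C_i$ and $c\in\Bbbk^*$ with $\omega(E)=cH$. Simplicity. For an $\mathcal{A}$-graded free module $F$ with $\mathcal{A}$-homogeneous basis $B=\{E_t\}$ and an $\mathcal{A}$-homogeneous $h=\sum_t(\sum_{\mathbf a}c_{t,\mathbf{a}}\mathbf{x}^{\mathbf{a}})E_t$, let $S_B(h)=\{\mathbf{x}^{\mathbf{a}}E_t:c_{t,\mathbf{a}}\ne0\}$.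 For an $\mathcal{A}$-graded subset $G\subset F$, a nonzero $\mathcal{A}$-homogeneous $h\in G$ is simple in $G$ with respect to $B$ if no nonzero $\mathcal{A}$-homogeneous $h'\in G$ satisfies $S_B(h')\subsetneq S_B(h)$. A based minimal free resolution $(\mathbf{G}_\bullet,\theta,\mathbf{C})$ of $R/I$ is simple if for each $i\ge1$ and each $E\in C_i$, $\theta_i(E)$ is simple in $\ker\theta_{i-1}$ with respect to $C_{i-1}$. Indispensable complex. A based complex $(\mathbf{F}_\bullet,\phi,\mathbf{B})$ is an indispensable complex of $R/I$ if for each based simple minimal free resolution $(\mathbf{G}_\bullet,\theta,\mathbf{C})$ of $R/I$ with $C_0=\{1\}$ there is an injective based homomorphism $\omega:(\mathbf{F}_\bullet,\phi,\mathbf{B})\to(\mathbf{G}_\bullet,\theta,\mathbf{C})$ with $\omega_0=\mathrm{id}_R$. Koszul complex. $K_t$ is free on the elements $e_J=e_{j_1}\wedge\cdots\wedge e_{j_t}$, $J=\{j_1<\cdots<j_t\}\subset\{1,\dots,s\}$, with $\deg_{\mathcal A}(e_J)=\sum_{j\in J}\mathbf{b}_j$ and $\phi_t(e_J)=\sum_{k=1}^t(-1)^{k+1}f_{j_k}\,e_{J\setminus\{j_k\}}$ (so $K_0=R$ and $\phi_1(e_i)=f_i$). The canonical system of bases is $\mathbf{B}=(B_0,\dots,B_s)$ with $B_0=\{1\}$ and $B_t=\{e_J:|J|=t\}$. *)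

(* Defs.v *)
From HB Require Import structures.
From mathcomp Require Import all_boot all_order all_algebra.
From mathcomp Require Import generic_quotient ring_quotient.
From mathcomp Require Import mpoly.

Set Implicit Arguments.
Unset Strict Implicit.
Unset Printing Implicit Defensive.

Import GRing.Theory.
Local Open Scope ring_scope.
Local Open Scope quotient_scope.

Section Degrees.

Variables (n : nat) (L : zmodClosed 'rV[int]_n).

Definition pointed_lattice : Prop :=
  forall v : 'rV[int]_n, v \in L -> (forall i, 0 <= v ord0 i) -> v = 0.

(* The group Z^n / L; only group structure is used, so the name of the
   notation (which speaks of ideals) plays no role. *)
Definition degree : zmodType := {ideal_quot L}.

Definition deg_gen (i : 'I_n) : degree :=
  \pi_({ideal_quot L}) (delta_mx ord0 i).

Definition mdegA (m : 'X_{1..n}) : degree := \sum_(i < n) deg_gen i *+ m i.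

Definition in_semigroup (a : degree) : Prop := exists m, a = mdegA m.

Definition deg_ge (c d : degree) : Prop :=
  exists e, in_semigroup e /\ c = d + e.

Definition deg_incomparable (c d : degree) : Prop :=
  ~ deg_ge c d /\ ~ deg_ge d c.

End Degrees.

Section Ideals.

Variables (n : nat) (k : fieldType).
Implicit Types (S : {mpoly k[n]} -> Prop) (g r : {mpoly k[n]}).

Definition ideal_gen S r : Prop :=
  exists2 l : seq ({mpoly k[n]} * {mpoly k[n]}),
    forall p, p \in l -> S p.2 & r = \sum_(p <- l) p.1 * p.2.

Definition mnm_row (m : 'X_{1..n}) : 'rV[int]_n := \row_i (m i)%:Z.

Definition is_binomial g : Prop :=
  exists u v : 'X_{1..n}, g = 'X_[u] - 'X_[v].

Definition lattice_ideal (L : zmodClosed 'rV[int]_n) : {mpoly k[n]} -> Prop :=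
  ideal_gen (fun g => exists u v : 'X_{1..n},
    mnm_row u - mnm_row v \in L /\ g = 'X_[u] - 'X_[v]).

Variables (s : nat) (f : 'I_s -> {mpoly k[n]}).

Definition ideal_of : {mpoly k[n]} -> Prop :=
  ideal_gen (fun g => exists i, g = f i).

Definition ideal_of_lt (i : 'I_s) : {mpoly k[n]} -> Prop :=
  ideal_gen (fun g => exists2 j : 'I_s, (j < i)%N & g = f j).

Definition regular_sequence : Prop :=
  (forall i g, ideal_of_lt i (f i * g) -> ideal_of_lt i g) /\
  ~ ideal_of 1.

End Ideals.

(* [freemod n k C] is the free module over {mpoly k[n]} with basis C; an element
   is its family of coordinates.  The regular module R^o is what makes the
   scalars be polynomials rather than elements of k. *)
Definition freemod (n : nat) (k : fieldType) (C : finType) :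
    lmodType {mpoly k[n]} :=
  {ffun C -> {mpoly k[n]}^o}.

Section Free.

Variables (n : nat) (k : fieldType) (L : zmodClosed 'rV[int]_n).

Definition fcoord (C : finType) (h : freemod n k C) (t : C) : {mpoly k[n]} :=
  (h : {ffun C -> {mpoly k[n]}^o}) t.

Definition bvec (C : finType) (t : C) : freemod n k C :=
  [ffun u => (u == t)%:R : {mpoly k[n]}^o].

Section LinExt.

Variables (C D : finType) (phi : C -> freemod n k D).

Definition lin_ext (h : freemod n k C) : freemod n k D :=
  \sum_(t : C) fcoord h t *: phi t.

Lemma lin_ext_is_linear : linear lin_ext.
Proof.
move=> a u v; rewrite /lin_ext scaler_sumr -big_split; apply: eq_bigr => t _.
by rewrite /fcoord !ffunE scalerDl scalerA.
Qed.

HB.instance Definition _ :=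
  GRing.isLinear.Build _ _ _ _ lin_ext lin_ext_is_linear.

End LinExt.

Definition homog_poly (a : degree L) (g : {mpoly k[n]}) : Prop :=
  forall m, m \in msupp g -> mdegA L m = a.

(* The zero vector is homogeneous of every degree. *)
Definition homogeneous (C : finType) (deg : C -> degree L) (a : degree L)
    (h : freemod n k C) : Prop :=
  forall t m, m \in msupp (fcoord h t) -> mdegA L m + deg t = a.

Definition degree_preserving (C D : finType)
    (degC : C -> degree L) (degD : D -> degree L)
    (w : freemod n k C -> freemod n k D) : Prop :=
  forall a h, homogeneous degC a h -> homogeneous degD a (w h).

(* The set S_B(h), with x^m E_t encoded as the pair (m, t). *)
Definition term_supp (C : finType) (h : freemod n k C) : pred ('X_{1..n} * C) :=
  [pred p | (fcoord h p.2)@_p.1 != 0].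

Definition simple_in (C : finType) (deg : C -> degree L)
    (G : freemod n k C -> Prop) (h : freemod n k C) : Prop :=
  [/\ h != 0, G h, exists a, homogeneous deg a h &
    ~ exists h' : freemod n k C,
        [/\ h' != 0, G h', exists a, homogeneous deg a h',
            {subset term_supp h' <= term_supp h} &
            ~ {subset term_supp h <= term_supp h'}]].

End Free.

(* A free module together with a homogeneous basis is given by the finite basis
   and the degrees of its elements; [bdiff i] is theta_(i+1). *)
Record based_data (n : nat) (k : fieldType) (L : zmodClosed 'rV[int]_n) :=
  BasedData {
    basis : nat -> finType;
    bdeg : forall i, basis i -> degree L;
    bdiff : forall i, {linear freemod n k (basis i.+1) -> freemod n k (basis i)}
  }.

Section Complexes.

Variables (n : nat) (k : fieldType) (L : zmodClosed 'rV[int]_n).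
Implicit Types (F G : based_data k L) (I : {mpoly k[n]} -> Prop).

Definition based_complex F : Prop :=
  [/\ forall i (E : basis F i), in_semigroup (bdeg E),
      forall i, degree_preserving (@bdeg _ _ _ F i.+1) (@bdeg _ _ _ F i)
                                  (bdiff F i) &
      forall i h, bdiff F i (bdiff F i.+1 h) = 0].

(* The degree-zero module is R, with basis {1}. *)
Definition starts_with_one F : Prop :=
  #|basis F 0| = 1%N /\ forall E : basis F 0, bdeg E = 0.

(* The identification of R with the degree-zero module, under
   [starts_with_one]. *)
Definition in0 F (r : {mpoly k[n]}) : freemod n k (basis F 0) :=
  [ffun => r : {mpoly k[n]}^o].

(* [ker_diff I F i] is ker theta_i, where theta_0 is the projection R -> R/I. *)
Definition ker_diff I F (i : nat) : freemod n k (basis F i) -> Prop :=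
  match i with
  | 0 => fun h => exists2 r, I r & h = in0 F r
  | j.+1 => fun h => bdiff F j h = 0
  end.

(* Based minimal free resolutions of R/I with G_0 = R and C_0 = {1}. *)
Definition minimal_free_resolution I G : Prop :=
  [/\ based_complex G, starts_with_one G,
      exists p, forall i, (p < i)%N -> #|basis G i| = 0%N,
      forall i h, ker_diff I h <-> exists h', h = bdiff G i h' &
      forall i h, exists g : 'I_n -> freemod n k (basis G i),
        bdiff G i h = \sum_(j < n) ('X_j : {mpoly k[n]}) *: g j].

Definition simple_resolution I G : Prop :=
  minimal_free_resolution I G /\
  forall i (E : basis G i.+1),
    simple_in (@bdeg _ _ _ G i) (@ker_diff I G i) (bdiff G i (bvec n k E)).

Definition complex_hom F G
    (w : forall i,
      {linear freemod n k (basis F i) -> freemod n k (basis G i)}) : Prop :=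
  (forall i, degree_preserving (@bdeg _ _ _ F i) (@bdeg _ _ _ G i) (w i)) /\
  forall i h, w i (bdiff F i h) = bdiff G i (w i.+1 h).

Definition based_hom F G
    (w : forall i,
      {linear freemod n k (basis F i) -> freemod n k (basis G i)}) : Prop :=
  complex_hom w /\
  forall i (E : basis F i), exists (H : basis G i) (c : k),
    c != 0 /\ w i (bvec n k E) = c%:MP *: bvec n k H.

(* [starts_with_one F] is what gives the condition omega_0 = id_R a meaning. *)
Definition indispensable_complex I F : Prop :=
  [/\ based_complex F, starts_with_one F &
    forall G, simple_resolution I G ->
      exists w : forall i,
          {linear freemod n k (basis F i) -> freemod n k (basis G i)},
        [/\ based_hom w, forall i, injective (w i) &
            forall r, w 0%N (in0 F r) = in0 G r]].

End Complexes.

Section Koszul.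

Variables (n : nat) (k : fieldType) (L : zmodClosed 'rV[int]_n).
Variables (s : nat) (f : 'I_s -> {mpoly k[n]}) (b : 'I_s -> degree L).

Definition koszul_basis (t : nat) : finType := {J : {set 'I_s} | #|J| == t}.

Definition koszul_deg (t : nat) (J : koszul_basis t) : degree L :=
  \sum_(j in val J) b j.

(* The sign exponent is the zero-based position of j in J. *)
Definition koszul_bd (t : nat) (J : koszul_basis t.+1) :
    freemod n k (koszul_basis t) :=
  [ffun J' : koszul_basis t =>
     (\sum_(j in val J | val J' == val J :\ j)
        (-1) ^+ #|[set l in val J | (l < j)%N]| * f j) : {mpoly k[n]}^o].

Definition koszul : based_data k L :=
  BasedData koszul_deg (fun t => lin_ext (@koszul_bd t)).

End Koszul.

(* Main.v *)
Require Import Defs.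
From mathcomp Require Import all_boot all_order all_algebra.
From mathcomp Require Import mpoly.
From HB Require Import structures.
From mathcomp Require Import generic_quotient ring_quotient ring.
(* [mpoly] shadows [basis]. *)
Import Defs.

Set Implicit Arguments.
Unset Strict Implicit.
Unset Printing Implicit Defensive.

Import GRing.Theory.
Local Open Scope ring_scope.
Local Open Scope quotient_scope.

(* Let F be an exact based complex whose differential has no constant terms, let
   G be a simple minimal free resolution, and suppose that F and G have been
   identified, bases included, up to step i.  The boundary of a basis element E
   of G_(i+1) becomes the boundary of some h in F_(i+1), homogeneous of degree
   deg E.  By minimality h has a coordinate with a nonzero constant term c, say
   at J, so deg J = deg E and this coordinate is c.  For the Koszul complex, the
   coordinates of h that could interfere with the boundary of c e_J have degrees
   b_j - b_i with i <> j, and vanish by incomparability.  Hence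
   d (h - c e_J) has strictly smaller support than d h, and is zero by
   simplicity: E is matched with J.  Minimality of both complexes makes this
   matching a bijection and the induction goes on.  Exactness of the Koszul
   complex of a regular sequence is the usual mapping cone induction. *)

(** * Degrees and free modules *)

Section LatticeDegrees.

Variables (n : nat) (L : zmodClosed 'rV[int]_n).

Lemma mdegA0 : mdegA L 0%MM = 0.
Proof. by rewrite /mdegA big1 // => i _; rewrite mnm0E mulr0n. Qed.

Lemma mdegAD (u v : 'X_{1..n}) : mdegA L (u + v)%MM = mdegA L u + mdegA L v.
Proof.
by rewrite -big_split; apply: eq_bigr => i _; rewrite mnmDE mulrnDr.
Qed.

Lemma mdegAE (u : 'X_{1..n}) : mdegA L u = \pi_({ideal_quot L}) (mnm_row u).
Proof.
have -> : mnm_row u = \sum_i delta_mx ord0 i *+ u i.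
  apply/rowP => j; rewrite mxE summxE (bigD1 j) //= big1 => [|i ij].
    by rewrite mulmxnE mxE !eqxx addr0 pmulrn intz.
  by rewrite mulmxnE mxE eqxx eq_sym (negbTE ij) mul0rn.
rewrite /mdegA; elim/big_ind2: _ => [|x1 x2 y1 y2 -> ->|i _].
- by rewrite raddf0.
- by rewrite raddfD.
- by rewrite raddfMn.
Qed.

Hypothesis hL : pointed_lattice L.

(** The exponent vector of a monomial of degree zero lies in [L] and is nonnegative, so pointedness
    forces it to vanish. *)
Lemma mdegA_eq0 (u : 'X_{1..n}) : mdegA L u = 0 -> u = 0%MM.
Proof.
rewrite mdegAE => u0.
have /hL: mnm_row u \in L.
  by rewrite -[mnm_row u]subr0 Quotient.idealrBE u0 raddf0.
move=> h; apply/mnmP => i; rewrite mnm0E.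
have /rowP/(_ i) := h (fun j => ltac:(by rewrite mxE)).
by rewrite !mxE => -[].
Qed.

Lemma homog_poly0 (k : fieldType) (g : {mpoly k[n]}) :
  homog_poly (0 : degree L) g -> g = (g@_0%MM)%:MP.
Proof.
move=> hg; apply/mpolyP => m; rewrite mcoeffC.
have [->|m0] := eqVneq m 0%MM; first by rewrite mulr1.
rewrite mulr0; apply/eqP; rewrite mcoeff_eq0; apply/negP => /hg/mdegA_eq0.
by move/eqP; rewrite (negbTE m0).
Qed.

End LatticeDegrees.

Section FreeModules.

Variables (n : nat) (k : fieldType) (L : zmodClosed 'rV[int]_n).
Implicit Types (C D : finType).

Lemma freemodP C (x y : freemod n k C) :
  (forall t, fcoord x t = fcoord y t) -> x = y.
Proof. by move=> xy; apply/ffunP. Qed.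

Lemma fcoord0 C (t : C) : fcoord (0 : freemod n k C) t = 0.
Proof. by rewrite /fcoord ffunE. Qed.

Lemma fcoordD C (x y : freemod n k C) t :
  fcoord (x + y) t = fcoord x t + fcoord y t.
Proof. by rewrite /fcoord ffunE. Qed.

Lemma fcoordN C (x : freemod n k C) t : fcoord (- x) t = - fcoord x t.
Proof. by rewrite /fcoord ffunE. Qed.

Lemma fcoordB C (x y : freemod n k C) t :
  fcoord (x - y) t = fcoord x t - fcoord y t.
Proof. by rewrite fcoordD fcoordN. Qed.

Lemma fcoordZ C a (x : freemod n k C) t : fcoord (a *: x) t = a * fcoord x t.
Proof. by rewrite /fcoord ffunE. Qed.

Lemma fcoord_sum C (J : Type) (r : seq J) P (F : J -> freemod n k C) t :
  fcoord (\sum_(j <- r | P j) F j) t = \sum_(j <- r | P j) fcoord (F j) t.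
Proof.
elim/big_rec2: _ => [|j x y _ <-]; first exact: fcoord0.
exact: fcoordD.
Qed.

Lemma fcoord_bvec C (t u : C) : fcoord (bvec n k t) u = (u == t)%:R.
Proof. by rewrite /fcoord ffunE. Qed.

Lemma freemod_sum_bvec C (h : freemod n k C) :
  h = \sum_t fcoord h t *: bvec n k t.
Proof.
apply: freemodP => u; rewrite fcoord_sum (bigD1 u) //=.
rewrite [X in _ = X + _]fcoordZ fcoord_bvec eqxx mulr1 big1 ?addr0 // => t tu.
by rewrite fcoordZ fcoord_bvec eq_sym (negbTE tu) mulr0.
Qed.

Lemma freemod_linB C D (phi : {linear freemod n k C -> freemod n k D}) u v :
  phi (u - v) = phi u - phi v.
Proof. exact: raddfB. Qed.

Lemma freemod_linZ C D (phi : {linear freemod n k C -> freemod n k D}) a u :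
  phi (a *: u) = a *: phi u.
Proof. exact: linearZ_LR. Qed.

Lemma freemod_lin_sum C D (phi : {linear freemod n k C -> freemod n k D})
    (J : Type) (r : seq J) P (F : J -> freemod n k C) :
  phi (\sum_(j <- r | P j) F j) = \sum_(j <- r | P j) phi (F j).
Proof. exact: raddf_sum. Qed.

Lemma linear_bvec C (V : lmodType {mpoly k[n]})
    (phi : {linear freemod n k C -> V}) (h : freemod n k C) :
  phi h = \sum_t fcoord h t *: phi (bvec n k t).
Proof.
rewrite {1}[h]freemod_sum_bvec raddf_sum.
by apply: eq_bigr => t _; rewrite /= linearZ_LR.
Qed.

Lemma lin_ext_bvec C D (phi : C -> freemod n k D) t :
  lin_ext phi (bvec n k t) = phi t.
Proof.
rewrite /lin_ext (bigD1 t) //= fcoord_bvec eqxx scale1r big1 ?addr0 // => u ut.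
by rewrite fcoord_bvec (negbTE ut) scale0r.
Qed.

Lemma homogeneousD C (deg : C -> degree L) a (x y : freemod n k C) :
  homogeneous deg a x -> homogeneous deg a y -> homogeneous deg a (x + y).
Proof.
move=> hx hy t m; rewrite fcoordD => /msuppD_le; rewrite mem_cat => /orP[].
  exact: hx.
exact: hy.
Qed.

Lemma homogeneousCZ C (deg : C -> degree L) a c (x : freemod n k C) :
  homogeneous deg a x -> homogeneous deg a (c%:MP *: x).
Proof.
move=> hx t m; rewrite fcoordZ mcoeff_msupp mcoeffCM mulf_eq0 negb_or.
by rewrite -mcoeff_msupp => /andP[_]; apply: hx.
Qed.

Lemma homogeneousN C (deg : C -> degree L) a (x : freemod n k C) :
  homogeneous deg a x -> homogeneous deg a (- x).
Proof.
move=> hx t m; rewrite fcoordN (perm_mem (msuppN _)); exact: hx.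
Qed.

Lemma homogeneousB C (deg : C -> degree L) a (x y : freemod n k C) :
  homogeneous deg a x -> homogeneous deg a y -> homogeneous deg a (x - y).
Proof. by move=> hx hy; apply: homogeneousD => //; apply: homogeneousN. Qed.

Lemma homogeneous_bvec C (deg : C -> degree L) t :
  homogeneous deg (deg t) (bvec n k t).
Proof.
move=> u m; rewrite fcoord_bvec; case: eqVneq => [->|_]; last first.
  by rewrite msupp0.
by rewrite msupp1 inE => /eqP->; rewrite mdegA0 add0r.
Qed.

(** Exactness supplies preimages that need not be homogeneous; this truncation makes them so. *)
Definition homog_component C (deg : C -> degree L) (a : degree L)
    (h : freemod n k C) : freemod n k C :=
  [ffun t => (\sum_(m <- msupp (fcoord h t) | mdegA L m + deg t == a)
                (fcoord h t)@_m *: 'X_[m] : {mpoly k[n]}^o)].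

Lemma homog_componentE C (deg : C -> degree L) a (h : freemod n k C) t m :
  (fcoord (homog_component deg a h) t)@_m =
  if mdegA L m + deg t == a then (fcoord h t)@_m else 0.
Proof.
rewrite {1}/fcoord ffunE raddf_sum /=.
under eq_bigr do rewrite mcoeffZ mcoeffX.
have [mh|mh] := boolP (m \in msupp (fcoord h t)); last first.
  rewrite big1_seq => [|j /andP[_ jh]]; last first.
    by case: eqVneq => [jm|_]; rewrite ?mulr0 //; rewrite jm (negbTE mh) in jh.
  by move: mh; rewrite -mcoeff_eq0 => /eqP->; rewrite if_same.
rewrite -big_filter; case: ifP => am.
  rewrite (bigD1_seq m) /= ?mem_filter ?am ?filter_uniq ?msupp_uniq //.
  rewrite eqxx mulr1 big1 ?addr0 // => j jm.
  by rewrite (negbTE jm) mulr0.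
rewrite big1_seq // => j /= ; rewrite mem_filter => /andP[aj _].
by case: eqVneq => [jm|_]; rewrite ?mulr0 //; rewrite jm am in aj.
Qed.

Lemma homog_component_homogeneous C (deg : C -> degree L) a
    (h : freemod n k C) :
  homogeneous deg a (homog_component deg a h).
Proof.
move=> t m; rewrite mcoeff_msupp homog_componentE.
by case: ifP => [/eqP|]; rewrite ?eqxx.
Qed.

(** The difference [w] of the two chains has no term of degree [a], hence neither has its image;
    that image is also homogeneous of degree [a], so it is zero. *)
Lemma degree_preserving_hcomp C D (degC : C -> degree L) (degD : D -> degree L)
    (phi : {linear freemod n k C -> freemod n k D}) a (h : freemod n k C) :
    degree_preserving degC degD phi -> homogeneous degD a (phi h) ->
  phi (homog_component degC a h) = phi h.
Proof.
move=> dphi hz.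
apply/eqP; rewrite -subr_eq0 -raddfB /=.
set w := _ - h.
have hw : homogeneous degD a (phi w).
  rewrite raddfB; apply: homogeneousB => //.
  exact/dphi/homog_component_homogeneous.
have w0 t m : m \in msupp (fcoord w t) -> mdegA L m + degC t <> a.
  rewrite mcoeff_msupp fcoordB mcoeffB homog_componentE.
  case: ifP => [_|/eqP //].
  by rewrite subrr eqxx.
apply/eqP/freemodP => u; apply/mpolyP => m; rewrite fcoord0 mcoeff0.
have [ma|ma] := eqVneq (mdegA L m + degD u) a; last first.
  by apply/eqP; rewrite mcoeff_eq0; apply: contraNN ma => /hw ->.
rewrite linear_bvec fcoord_sum raddf_sum big1 // => t _ /=.
rewrite fcoordZ {1}[fcoord w t]mpolyE mulr_suml raddf_sum big1_seq // => j.
move=> /andP[_ jw] /=.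
rewrite -scalerAl mcoeffZ.
suff -> : ('X_[j] * fcoord (phi (bvec n k t)) u)@_m = 0 by rewrite mulr0.
rewrite -fcoordZ -linearZ_LR /=.
apply/eqP; rewrite mcoeff_eq0; apply/negP => ms.
apply: (w0 _ _ jw); rewrite -ma.
have hX : homogeneous degC (mdegA L j + degC t) ('X_[j] *: bvec n k t).
  move=> v m'; rewrite fcoordZ fcoord_bvec; case: eqVneq => [->|_].
    by rewrite mulr1 msuppX inE => /eqP->.
  by rewrite mulr0 msupp0.
by rewrite (dphi _ _ hX _ _ ms).
Qed.

End FreeModules.

(** * Comparison with a simple resolution *)

Section Relabelling.

Variables (n : nat) (k : fieldType) (C D : finType).
Implicit Type x : {ffun D -> C * k}.

(** The matching [x] runs from the target basis back to the source basis, so that the coordinates of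
    the image can be read off directly. *)
Definition relabel x (h : freemod n k C) : freemod n k D :=
  [ffun E => ((x E).2%:MP * fcoord h (x E).1 : {mpoly k[n]}^o)].

Lemma fcoord_relabel x h E :
  fcoord (relabel x h) E = (x E).2%:MP * fcoord h (x E).1.
Proof. by rewrite /fcoord ffunE. Qed.

Lemma relabel_is_linear x : linear (relabel x).
Proof.
move=> a u v; apply: freemodP => E.
by rewrite !(fcoordD, fcoordZ, fcoord_relabel) mulrDr mulrCA.
Qed.

HB.instance Definition _ x :=
  GRing.isLinear.Build _ _ _ _ (relabel x) (@relabel_is_linear x).

Definition is_relabelling x : Prop :=
  [/\ injective (fun E => (x E).1), forall J, exists E, (x E).1 = J &
      forall E, (x E).2 != 0].

Lemma relabel_inj x : is_relabelling x -> injective (relabel x).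
Proof.
case=> _ xsurj x0 u v uv; apply: freemodP => J; have [E <-] := xsurj J.
have /mulfI : (x E).2%:MP_[n] != 0 by rewrite mpolyC_eq0.
by apply; rewrite -!fcoord_relabel uv.
Qed.

Lemma relabel_bvec x E : is_relabelling x ->
  relabel x (bvec n k (x E).1) = (x E).2%:MP *: bvec n k E.
Proof.
case=> xinj _ _; apply: freemodP => E'.
rewrite fcoord_relabel fcoordZ !fcoord_bvec.
have -> : ((x E').1 == (x E).1) = (E' == E) by apply/eqP/eqP => [/xinj|->].
by case: eqVneq => [->|]; rewrite ?mulr0.
Qed.

Lemma relabel_surj x g : is_relabelling x -> exists h, relabel x h = g.
Proof.
move=> rx; have [_ _ x0] := rx.
exists (\sum_E (fcoord g E * (x E).2^-1%:MP) *: bvec n k (x E).1).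
rewrite [RHS]freemod_sum_bvec raddf_sum; apply: eq_bigr => E _ /=.
rewrite linearZ_LR /= (relabel_bvec E rx) scalerA -mulrA -mpolyCM.
by rewrite mulVf ?mulr1 // x0.
Qed.

Lemma relabel_homogeneous (L : zmodClosed 'rV[int]_n) (degC : C -> degree L)
    (degD : D -> degree L) x a h :
    is_relabelling x -> (forall E, degD E = degC (x E).1) ->
  homogeneous degD a (relabel x h) <-> homogeneous degC a h.
Proof.
case=> _ xsurj x0 degx.
have supp E m : (m \in msupp (fcoord (relabel x h) E))
    = (m \in msupp (fcoord h (x E).1)).
  rewrite !mcoeff_msupp fcoord_relabel mcoeffCM mulf_eq0.
  by rewrite (negbTE (x0 E)).
split=> hh; last by move=> E m; rewrite supp degx; apply: hh.
by move=> J m; have [E <-] := xsurj J; rewrite -supp -degx; apply: hh.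
Qed.

End Relabelling.

Section Comparison.

Variables (n : nat) (k : fieldType) (L : zmodClosed 'rV[int]_n).
Hypothesis hL : pointed_lattice L.
Variables (I : {mpoly k[n]} -> Prop) (F G : based_data k L).

Lemma ker_diffS (H : based_data k L) i (h : freemod n k (basis H i.+1)) :
  ker_diff I h <-> bdiff H i h = 0.
Proof. by []. Qed.

Definition exact_over : Prop :=
  forall i h, @ker_diff n k L I F i h <-> exists h', h = bdiff F i h'.

Definition minimal_diff (H : based_data k L) : Prop :=
  forall i h t, (fcoord (bdiff H i h) t)@_0%MM = 0.

(* Thus subtracting from a homogeneous chain of degree [bdeg E] its component
   on [E] strictly shrinks the support of the boundary. *)
Definition isolated_basis : Prop :=
  forall i (E : basis F i.+1) h, homogeneous (@bdeg _ _ _ F i.+1) (bdeg E) h ->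
    fcoord h E = 0 -> forall t, fcoord (bdiff F i (bvec n k E)) t != 0 ->
    fcoord (bdiff F i h) t = 0.

Hypotheses (cF : based_complex F) (sF : starts_with_one F) (eF : exact_over).
Hypotheses (mF : minimal_diff F) (iF : isolated_basis).
Hypothesis sG : simple_resolution I G.

Let cG : based_complex G. Proof. by case: sG => -[]. Qed.
Let s1G : starts_with_one G. Proof. by case: sG => -[]. Qed.
Let eG i h : @ker_diff n k L I G i h <-> exists h', h = bdiff G i h'.
Proof. by case: sG => -[_ _ _ + _] _; apply. Qed.

Let mG : minimal_diff G.
Proof.
case: sG => -[_ _ _ _ min] _ i h t; have [g ->] := min i h.
rewrite fcoord_sum raddf_sum big1 // => j _ /=.
rewrite fcoordZ rmorphM /= mcoeffX; case: eqVneq => [/mnmP/(_ j)|].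
  by rewrite mnm0E mnm1E eqxx.
by rewrite mul0r.
Qed.

Let ker_diffZ i (a : {mpoly k[n]}) h :
  @ker_diff n k L I G i h -> ker_diff (F := G) I (a *: h).
Proof.
rewrite !eG => -[h' ->]; exists (a *: h'); by rewrite linearZ_LR.
Qed.

Definition relabelling i := {ffun basis G i -> basis F i * k}.

(** The induction invariant. The matching of cycles is what allows exactness to be applied on either
    side at the next step. *)
Definition compatible i (x : relabelling i) : Prop :=
  [/\ is_relabelling x, forall E, bdeg E = bdeg (x E).1 &
      forall h, ker_diff (F := F) I h <-> ker_diff (F := G) I (relabel x h)].

(** Boolean, so that [xchoose] can pick a lift. The scalar is inverted because [relabel y] sends the
    basis vector at [(y E).1] to [(y E).2] times the one at [E]. *)
Definition lifts i (x : relabelling i) (y : relabelling i.+1) : bool :=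
  [forall E, bdiff G i (bvec n k E)
               == (y E).2^-1%:MP *: relabel x (bdiff F i (bvec n k (y E).1))]
  && [forall E, ((y E).2 != 0) && (bdeg E == bdeg (y E).1)].

Section Step.

Variables (i : nat) (x : relabelling i).
Hypothesis hx : compatible x.

Let relabel_cycle h : @ker_diff n k L I G i (relabel x (bdiff F i h)).
Proof. by case: hx => _ _ <-; apply/eF; exists h. Qed.

Lemma lift_basis (E : basis G i.+1) : exists J : basis F i.+1 * k,
  [/\ J.2 != 0, bdeg E = bdeg J.1 & bdiff G i (bvec n k E)
               = J.2^-1%:MP *: relabel x (bdiff F i (bvec n k J.1))].
Proof.
case: (hx) => rx degx kx.
have [_ dG _] := cG; have [_ dF _] := cF.
set z := bdiff G i (bvec n k E).
have kz : ker_diff (F := G) I z by apply/eG; exists (bvec n k E).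
have hz : homogeneous (@bdeg _ _ _ G i) (bdeg E) z.
  exact/dG/homogeneous_bvec.
have [u uz] := relabel_surj z rx.
have [h0 uh0] : exists h', u = bdiff F i h'.
  by apply/eF/kx; rewrite uz.
have hu : homogeneous (@bdeg _ _ _ F i) (bdeg E) u.
  by rewrite -(relabel_homogeneous _ _ rx degx) uz.
(* The truncated preimage still has boundary [u], since [u] is homogeneous of degree [bdeg E]. *)
pose h := homog_component (@bdeg _ _ _ F i.+1) (bdeg E) h0.
have hh : homogeneous (@bdeg _ _ _ F i.+1) (bdeg E) h.
  exact: homog_component_homogeneous.
have uh : u = bdiff F i h.
  by rewrite [RHS](degree_preserving_hcomp (dF i)) -?uh0.
(* Otherwise [z] is also the boundary of a chain without constant terms; its difference with [E] is
   a cycle, hence a boundary, whose coordinate at [E] has constant term 1, against minimality of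
   [G]. *)
have [J hJ] : exists J, (fcoord h J)@_0%MM != 0.
  apply/existsP; apply: contraT => /existsPn noJ.
  have /fin_all_exists[g gP] (J : basis F i.+1) : exists g,
      relabel x (bdiff F i (bvec n k J)) = bdiff G i g by apply/eG.
  have zE : z = bdiff G i (\sum_J fcoord h J *: g J).
    rewrite -uz uh linear_bvec !raddf_sum; apply: eq_bigr => J _ /=.
    by rewrite !linearZ_LR /= gP.
  have /eG[w wE] : @ker_diff n k L I G i.+1
      (bvec n k E - \sum_J fcoord h J *: g J).
    by rewrite /= raddfB /= -zE subrr.
  have := mG w E; rewrite -wE fcoordB fcoord_bvec eqxx fcoord_sum.
  rewrite raddfB raddf_sum /= mcoeff1 eqxx big1 => [/eqP|J _].
    by rewrite subr0 oner_eq0.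
  by rewrite fcoordZ rmorphM /= (eqP (negPn (noJ J))) mul0r.
have degEJ : bdeg E = bdeg J.
  by rewrite -(hh J 0%MM) ?mdegA0 ?add0r // mcoeff_msupp.
set c := (fcoord h J)@_0%MM in hJ.
(* This coordinate is homogeneous of degree 0, hence constant by pointedness. *)
have hJc : fcoord h J = c%:MP.
  apply: (homog_poly0 hL) => m /hh hm.
  by apply: (addIr (bdeg J)); rewrite hm add0r.
exists (J, c^-1); split; rewrite //= ?invr_eq0 // invrK.
(* Clearing the coordinate at [J] gives, by isolation, a boundary that vanishes wherever the
   boundary of [e_J] does not. *)
pose h1 := h - c%:MP *: bvec n k J.
pose z1 := relabel x (bdiff F i h1).
have z1E : z1 = z - c%:MP *: relabel x (bdiff F i (bvec n k J)).
  by rewrite /z1 /h1 raddfB /= raddfB /= !linearZ_LR -uh uz.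
have hh1 : homogeneous (@bdeg _ _ _ F i.+1) (bdeg J) h1.
  rewrite -degEJ; apply: homogeneousB => //; apply: homogeneousCZ.
  by rewrite degEJ; apply: homogeneous_bvec.
have h1J : fcoord h1 J = 0.
  by rewrite fcoordB fcoordZ fcoord_bvec eqxx mulr1 hJc subrr.
have z10 t : fcoord (bdiff F i (bvec n k J)) (x t).1 != 0 -> fcoord z1 t = 0.
  by move=> /(iF hh1 h1J) tJ; rewrite fcoord_relabel tJ mulr0.
apply/eqP; rewrite -subr_eq0 -z1E; apply/negP => /negP z1n0.
have [z0 _ _] := sG.2 _ E; apply.
(* If nonzero, [z1] contradicts simplicity of [z]: it agrees with [z] where the boundary of [e_J]
   vanishes and is zero elsewhere. *)
exists z1; split=> //.
- exact: relabel_cycle.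
- by exists (bdeg J); apply/(relabel_homogeneous _ _ rx degx); apply: dF.
- move=> [m t]; rewrite !inE /=.
  have [tJ|/z10 ->] := eqVneq (fcoord (bdiff F i (bvec n k J)) (x t).1) 0.
    by rewrite z1E fcoordB fcoordZ fcoord_relabel tJ !mulr0 subr0.
  by rewrite mcoeff0 eqxx.
(* The inclusion of supports is strict because [e_J] is not a cycle: by exactness it would be a
   boundary with constant term 1, against minimality of [F]. *)
have [tJ] : exists tJ, fcoord (bdiff F i (bvec n k J)) tJ != 0.
  apply/existsP; apply: contraT => /existsPn noJ.
  have /eF[w wE] : @ker_diff n k L I F i.+1 (bvec n k J).
    by apply: freemodP => t; rewrite fcoord0; apply/eqP/negPn/noJ.
  have := mF w J; rewrite -wE fcoord_bvec eqxx mcoeff1 eqxx => /eqP.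
  by rewrite oner_eq0.
case: (rx) => _ xsurj x0; have [t <-] := xsurj tJ => tn0 sub.
have zt : fcoord z t != 0.
  move/eqP: z1E; rewrite eq_sym subr_eq => /eqP ->.
  rewrite fcoordD (z10 _ tn0) add0r fcoordZ fcoord_relabel.
  by rewrite !mulf_neq0 // mpolyC_eq0.
have [m mz] : exists m, m \in msupp (fcoord z t).
  move: zt; rewrite -msupp_eq0; case: (msupp _) => // m s _.
  by exists m; rewrite mem_head.
have := sub (m, t); rewrite !inE /= -mcoeff_msupp mz => /(_ isT).
by rewrite z10 // mcoeff0 eqxx.
Qed.

Lemma lift_exists : exists y, lifts x y.
Proof.
have /fin_all_exists[Y hY] := lift_basis; exists [ffun E => Y E].
apply/andP; split; apply/forallP => E; rewrite ffunE; case: (hY E).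
  by move=> _ _ /eqP.
by move=> -> -> _; rewrite eqxx.
Qed.

(** Minimality makes the lift bijective: a repeated value gives a cycle of [G], and a missed basis
    element a cycle of [F], with a nonzero constant coordinate, while every cycle there is a
    boundary. *)
Lemma compatible_lift y : lifts x y ->
  compatible y /\
  forall h, relabel x (bdiff F i h) = bdiff G i (relabel y h).
Proof.
case/andP=> /forallP/= yE /forallP yP.
have y0 E : (y E).2 != 0 by case/andP: (yP E).
have degy E : bdeg E = bdeg (y E).1 by case/andP: (yP E) => _ /eqP.
have [rx degx kx] := hx.
have [v vE] : exists v, forall E, v E = (y E).2%:MP *: bvec n k E.
  by exists (fun E => (y E).2%:MP *: bvec n k E).
have vc E u : fcoord (v E) u = (y E).2%:MP * (u == E)%:R.
  by rewrite vE fcoordZ fcoord_bvec.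
have gE E : bdiff G i (v E) = relabel x (bdiff F i (bvec n k (y E).1)).
  rewrite vE linearZ_LR (eqP (yE E)) scalerA -mpolyCM mulfV // scale1r //.
have yinj : injective (fun E => (y E).1).
  move=> E E' /= EE'; apply/eqP; apply: contraT => nEE'.
  have /eG[w wE] : @ker_diff n k L I G i.+1 (v E - v E').
    by apply/ker_diffS; rewrite freemod_linB (gE E) (gE E') EE' subrr.
  have := mG w E; rewrite -wE fcoordB !vc eqxx.
  rewrite (negbTE nEE') mulr1 mulr0 subr0 mcoeffC eqxx mulr1 => /eqP.
  by rewrite (negbTE (y0 E)).
have ysurj J : exists E, (y E).1 = J.
  have /existsP[E /eqP] : [exists E, (y E).1 == J]; last by exists E.
  apply: contraT => /existsPn noE.
  have /eG[g gJ] := relabel_cycle (bvec n k J).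
  (* The preimage of [g] under the lift: its boundary equals that of [e_J], yet it has no coordinate
     at [J]. *)
  pose u := \sum_E (fcoord g E * (y E).2^-1%:MP) *: bvec n k (y E).1.
  have gu : relabel x (bdiff F i u) = bdiff G i g.
    rewrite [RHS]linear_bvec !freemod_lin_sum; apply: eq_bigr => E _.
    by rewrite !freemod_linZ (eqP (yE E)) scalerA.
  have /eF[w wE] : @ker_diff n k L I F i.+1 (bvec n k J - u).
    apply/ker_diffS/(relabel_inj rx); rewrite freemod_linB freemod_linB.
    by rewrite /= gu gJ subrr raddf0.
  have := mF w J; rewrite -wE fcoordB fcoord_bvec eqxx fcoord_sum big1.
    by rewrite subr0 mcoeff1 eqxx => /eqP; rewrite oner_eq0.
  by move=> E _; rewrite fcoordZ fcoord_bvec eq_sym (negbTE (noE E)) mulr0.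
have ry : is_relabelling y by [].
have comm h : relabel x (bdiff F i h) = bdiff G i (relabel y h).
  rewrite linear_bvec [in RHS](freemod_sum_bvec h) !raddf_sum.
  apply: eq_bigr => J _ /=; rewrite !linearZ_LR /=; congr (_ *: _).
  by have [E <-] := ysurj J; rewrite (relabel_bvec _ E ry) -vE gE.
split=> //; split=> //.
move=> h; rewrite /= -comm; split=> [->|]; first by rewrite raddf0.
by rewrite -(raddf0 (relabel x)) => /(relabel_inj rx).
Qed.

End Step.

Lemma fcoord_in0 (H : based_data k L) r E : fcoord (in0 H r) E = r.
Proof. by rewrite /fcoord ffunE. Qed.

Lemma compatible0 : exists x : relabelling 0,
  compatible x /\ forall r, relabel x (in0 F r) = in0 G r.
Proof.
have [/eqP/fintype1P[J0 FJ0] dF] := sF; have [/eqP/fintype1P[E0 GE0] dG] := s1G.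
(* The scalar 1 makes the map in degree 0 the identity of R. *)
exists [ffun=> (J0, 1)].
have in0E r : relabel [ffun=> (J0, 1)] (in0 F r) = in0 G r.
  by apply: freemodP => E; rewrite fcoord_relabel ffunE !fcoord_in0 mul1r.
have rx : is_relabelling ([ffun=> (J0, 1)] : relabelling 0).
  split=> [E E' _|J|E]; first by rewrite (GE0 E) (GE0 E').
    by exists E0; rewrite ffunE (FJ0 J).
  by rewrite ffunE oner_eq0.
split=> //; split=> // [E|h]; first by rewrite dF dG.
split=> -[r Ir hr]; exists r => //; first by rewrite hr in0E.
by apply: (relabel_inj rx); rewrite hr in0E.
Qed.

Lemma comparison : exists w : forall i,
    {linear freemod n k (basis F i) -> freemod n k (basis G i)},
  [/\ based_hom w, forall i, injective (w i) &
      forall r, w 0%N (in0 F r) = in0 G r].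
Proof.
have [x0 [cx0 x0E]] := compatible0.
(* Each stage carries its compatibility proof, since the choice of the next stage depends on it. *)
pose stage i := {x : relabelling i | compatible x}.
pose lift i (x : stage i) := lift_exists (svalP x).
pose step i (x : stage i) : stage i.+1 :=
  exist _ (xchoose (lift i x))
    (compatible_lift (svalP x) (xchooseP (lift i x))).1.
pose X := nat_rect stage (exist _ x0 cx0) step.
exists (fun i => relabel (sval (X i))).
split=> [|i|//]; last by have [rx _ _] := svalP (X i); apply: relabel_inj.
split; first split.
- move=> i a h; have [rx degx _] := svalP (X i).
  by move=> ?; apply/(relabel_homogeneous _ _ rx degx).
- move=> i h.
  exact: (compatible_lift (svalP (X i)) (xchooseP (lift i (X i)))).2.
- move=> i J; have [rx _ _] := svalP (X i).
  case: (rx) => _ /(_ J)[E <-] x0'; exists E, (sval (X i) E).2.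
  by split=> //; apply: relabel_bvec.
Qed.
End Comparison.

(** The Koszul complex enters the comparison only through these hypotheses, which are then checked
    one by one. *)
Theorem isolated_indispensable (n : nat) (k : fieldType)
    (L : zmodClosed 'rV[int]_n) (I : {mpoly k[n]} -> Prop)
    (F : based_data k L) :
    pointed_lattice L -> based_complex F -> starts_with_one F ->
    exact_over I F -> minimal_diff F -> isolated_basis F ->
  indispensable_complex I F.
Proof. by move=> *; split=> // G sG; apply: comparison. Qed.

(** * Exactness of the Koszul complex *)

Section KoszulDifferential.

Variables (R : comNzRingType) (s : nat) (f : 'I_s -> R).
Implicit Types (A : {set 'I_s}) (g u v w z : {set 'I_s} -> R).

(** For [j] outside [A], this is the zero-based position of [j] in [j |: A], the sign exponent of
    the differential. *)
Definition rank_in A (j : 'I_s) : nat := #|[set l in A | (l < j)%N]|.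

(* The Koszul differential on all degrees at once: [g A] is the coordinate at
   [e_A]. *)
Definition koszul_d g A : R :=
  \sum_(j | j \notin A) (-1) ^+ rank_in A j * f j * g (j |: A).

Lemma rank_inU1 A i j : i \notin A ->
  rank_in (i |: A) j = ((i < j)%N + rank_in A j)%N.
Proof.
move=> iA; rewrite /rank_in; have [ij|ij] := ltnP i j.
  have -> : [set l in i |: A | (l < j)%N] = i |: [set l in A | (l < j)%N].
    apply/setP => l; rewrite !inE; case: eqVneq => [->|//].
    by rewrite ij.
  by rewrite cardsU1 !inE (negbTE iA).
congr #|pred_of_set _|; apply/setP => l; rewrite !inE.
by case: eqVneq => [->|//]; rewrite (negbTE iA) ltnNge ij.
Qed.

(** The terms that insert [i < j] in the two possible orders cancel: inserting [i] first raises the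
    rank of [j] by one, while inserting [j] first leaves the rank of [i] unchanged. *)
Lemma koszul_dK g A : koszul_d (koszul_d g) A = 0.
Proof.
pose T j i := (-1) ^+ rank_in A j * f j *
  ((-1) ^+ rank_in (j |: A) i * f i * g (i |: (j |: A))).
transitivity (\sum_(j | j \notin A) \sum_(i | (i \notin A) && (i < j)%N) T j i +
              \sum_(j | j \notin A) \sum_(i | (i \notin A) && (j < i)%N) T j i).
  rewrite -big_split; apply: eq_bigr => j jA /=.
  rewrite mulr_sumr (bigID (fun i : 'I_s => (i < j)%N)) /=.
  congr (_ + _); apply: eq_bigl => i; rewrite !inE negb_or.
    by case: ltngtP => [ij|ij|/val_inj ->]; rewrite ?andbF ?eqxx // -val_eqE
      /= (ltn_eqF ij).
  by case: ltngtP => [ij|ij|/val_inj ->]; rewrite ?andbF ?eqxx // -val_eqE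
    /= (gtn_eqF ij).
rewrite [X in _ + X](exchange_big_dep (fun i => i \notin A)) /=; last first.
  by move=> ? ? _ /andP[].
rewrite -big_split big1 // => j jA /=.
rewrite [X in _ + X](eq_bigl (fun i => (i \notin A) && (i < j)%N)); last first.
  by move=> i; rewrite jA.
rewrite -big_split big1 // => i /andP[iA ij] /=.
rewrite /T !rank_inU1 // ij ltnNge (ltnW ij) add0n add1n exprS setUCA.
by ring.
Qed.

(** The chains of the Koszul complex on the first [r] elements of the sequence. *)
Definition supported r g :=
  forall A (j : 'I_s), j \in A -> (r <= j)%N -> g A = 0.

Lemma koszul_d_supported r g : supported r g -> supported r (koszul_d g).
Proof.
move=> gr A j jA rj; rewrite /koszul_d big1 // => i _.
by rewrite (gr _ j) ?mulr0 // !inE jA orbT.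
Qed.

Definition span_lt r (c : R) : Prop :=
  exists a : 'I_s -> R, c = \sum_(j : 'I_s | (j < r)%N) a j * f j.

Section Cone.

Variables (o : 'I_s) (z u v : {set 'I_s} -> R).
Hypotheses (ru : supported o u) (rv : supported o v).
Hypothesis zE : forall A, z A = if o \in A then v (A :\ o) else u A.

(** Here [z] is u + v ∧ e_o with [o] above all indices of [u] and [v]. Removing the last index [o]
    from [o |: A] costs the sign (-1)^|A|. *)
Lemma koszul_d_cone A : (forall j, j \in A -> (j < o)%N) ->
  koszul_d z A = koszul_d u A + (-1) ^+ #|A| * f o * v A.
Proof.
move=> Ao; have oA : o \notin A by apply/negP => /Ao; rewrite ltnn.
rewrite /koszul_d (bigD1 o) //= [in RHS](bigD1 o) //= addrAC; congr (_ + _).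
  rewrite zE setU11 setU1K // (ru (setU11 o A)) // mulr0 add0r.
  congr (_ ^+ _ * _ * _); apply: eq_card => l; rewrite !inE.
  by case lA: (l \in A) => //=; apply: Ao.
apply: eq_bigr => j /andP[jA jo].
by rewrite zE !inE eq_sym (negbTE jo) (negbTE oA).
Qed.

(** Only v ∧ e_o contributes to coordinates containing [o], and the index [o], being last, does not
    affect the signs of the others. *)
Lemma koszul_d_cone_top A : o \notin A -> koszul_d z (o |: A) = koszul_d v A.
Proof.
move=> oA; rewrite /koszul_d [RHS](bigD1 o) //= (rv (setU11 o A)) // mulr0.
rewrite add0r.
apply: eq_big => [j|j]; first by rewrite !inE negb_or andbC.
rewrite !inE negb_or => /andP[jo jA].
have -> : z (j |: (o |: A)) = v (j |: A).
  rewrite zE !inE eqxx orbT; congr v; rewrite setUCA setU1K //.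
  by rewrite !inE eq_sym (negbTE jo).
have [oj|jlo] := leqP o j; first by rewrite (rv (setU11 j A)) // !mulr0.
by rewrite rank_inU1 // ltnNge (ltnW jlo) add0n.
Qed.

End Cone.

Hypothesis reg : forall (r : 'I_s) c, span_lt r (f r * c) -> span_lt r c.

(** Mapping cone induction: write z = u + v ∧ e_o with [o] the index [r], bound [v] by some [w],
    correct [u] by [f o * w] up to sign, and bound the result by [y]. All homological degrees are
    treated at once; the condition on [z set0] expresses exactness in degree 0. *)
Lemma koszul_d_exact_lt r z : (r <= s)%N -> supported r z ->
    (forall A, koszul_d z A = 0) -> span_lt r (z set0) ->
  exists2 y, supported r y & forall A, koszul_d y A = z A.
Proof.
elim: r z => [|r IHr] z rs rz dz z0.
  (* With no generators [z] lives on the empty set, where it lies in the zero ideal. *)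
  exists (fun=> 0) => // A; rewrite /koszul_d big1 => [|j _]; last first.
    by rewrite mulr0.
  have [->|/set0Pn[j jA]] := eqVneq A set0; last by rewrite (rz A j).
  by case: z0 => a ->; rewrite big_pred0.
pose o := Ordinal rs.
pose v A := if o \in A then 0 else z (o |: A).
pose u A := if o \in A then 0 else z A.
have gtNo A j : o \notin A -> j \in A -> (o <= j)%N -> (r < j)%N.
  move=> oA jA; rewrite leq_eqVlt => /orP[/eqP/val_inj oj|//].
  by rewrite oj jA in oA.
have rv : supported o v.
  move=> A j jA oj; rewrite /v; case: ifPn => // oA; apply: (rz _ j).
    by rewrite !inE jA orbT.
  exact: (gtNo A).
have ru : supported o u.
  move=> A j jA oj; rewrite /u; case: ifPn => // oA; apply: (rz _ j) => //.
  exact: (gtNo A).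
have zE A : z A = if o \in A then v (A :\ o) else u A.
  by rewrite /v /u setD11; have [oA|] := boolP (o \in A); rewrite ?setD1K.
have below A : o \notin A -> ~~ [exists j in A, (o <= j)%N] ->
    forall j, j \in A -> (j < o)%N.
  by move=> oA /existsPn h j jA; have := h j; rewrite jA -ltnNge.
have dv A : koszul_d v A = 0.
  have [oA|oA] := boolP (o \in A); first exact: (koszul_d_supported rv oA).
  by rewrite -(koszul_d_cone_top rv zE oA).
(* At the empty set, [dz] puts [f o * v set0] in the ideal of the earlier elements; regularity
   cancels [f o]. *)
have v0 : span_lt r (v set0).
  apply: (reg (r := o)).
  have := koszul_d_cone ru zE (A := set0) (fun j => ltac:(by rewrite inE)).
  rewrite dz cards0 expr0 mul1r => /esym/eqP; rewrite addrC addr_eq0 => /eqP->.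
  exists (fun j => - ((-1) ^+ rank_in set0 j * u (j |: set0))).
  rewrite /koszul_d -sumrN [LHS](bigID (fun j : 'I_s => (j < o)%N)) /=.
  rewrite [X in _ + X]big1 => [|j /andP[_]]; last first.
    by rewrite -leqNgt => /(ru _ _ (setU11 j set0)) ->; rewrite mulr0 oppr0.
  rewrite addr0; apply: eq_big => [j|j _]; first by rewrite inE.
  by ring.
have [w0 rw0 dw0] := IHr v (ltnW rs) rv dv v0.
case: z0 => a z0.
(* The differential never reads the value at the empty set, so it can be reset to the coefficient of
   [f o] in [z set0]; this puts [u' set0] in the ideal of the first [r] elements. *)
pose w A := if A == set0 then a o else w0 A.
have rw : supported o w.
  move=> A j jA oj; rewrite /w; case: eqVneq => [A0|_]; last exact: (rw0 A j).
  by rewrite A0 inE in jA.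
have dw A : koszul_d w A = v A.
  rewrite -dw0; apply: eq_bigr => j _; rewrite /w.
  by case: eqVneq => // /setP/(_ j); rewrite !inE eqxx.
(* The factor (-1)^|A| changes sign under the differential, so d u' = d u + (-1)^|A| f_o v, which is
   the vanishing part of d z. *)
pose u' A := u A - (-1) ^+ #|A| * f o * w A.
have ru' : supported o u'.
  by move=> A j jA oj; rewrite /u' (ru _ _ jA oj) (rw _ _ jA oj) mulr0 subr0.
have du' A : koszul_d u' A = 0.
  have [/existsP[j /andP[jA oj]]|/negP Ao] := boolP [exists j in A, (o <= j)%N].
    exact: (koszul_d_supported ru' jA).
  have oA : o \notin A.
    by apply/negP => oA; apply: Ao; apply/existsP; exists o; rewrite oA /=.
  have -> : koszul_d u' A = koszul_d u A + (-1) ^+ #|A| * f o * koszul_d w A.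
    rewrite /koszul_d mulr_sumr -big_split; apply: eq_bigr => j jA /=.
    by rewrite /u' cardsU1 jA exprS; ring.
  by rewrite dw -(koszul_d_cone ru zE) //; apply: below => //; apply/negP.
have u'0 : span_lt r (u' set0).
  exists a; rewrite /u' /u inE cards0 /w eqxx z0 (bigD1 o) //=.
  rewrite mul1r mulrC addrAC subrr add0r; apply: eq_bigl => j.
  by rewrite ltnS andbC ltn_neqAle.
have [y ry dy] := IHr u' (ltnW rs) ru' du' u'0.
(* This is y + w ∧ e_o. *)
pose y' A := if o \in A then w (A :\ o) else y A.
exists y'.
  move=> A j jA oj; rewrite /y'; case: ifPn => oA; last first.
    exact: (ry A j jA (ltnW oj)).
  apply: (rw _ j); last exact: ltnW.
  rewrite !inE jA andbT; apply/eqP => jo.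
  by rewrite jo ltnn in oj.
move=> A; have [oA|oA] := boolP (o \in A).
  rewrite -(setD1K oA).
  rewrite (koszul_d_cone_top (o := o) (z := y') (u := y) rw) ?setD11 //.
  by rewrite dw /v setD11.
have [/existsP[j /andP[jA oj]]|Ao] := boolP [exists j in A, (o <= j)%N].
  rewrite (rz A j jA (gtNo _ _ oA jA oj)) /koszul_d big1 // => i _.
  rewrite /y' ; case: ifP => _.
    rewrite (rw _ j) ?mulr0 // !inE jA orbT andbT; apply/eqP => jo.
    by rewrite -jo jA in oA.
  by rewrite (ry _ j) ?mulr0 // !inE jA orbT.
rewrite (koszul_d_cone (o := o) (z := y') (v := w) ry) //; last exact: below.
by rewrite dy /u' subrK /u (negbTE oA).
Qed.

Lemma koszul_d_exact z :
    (forall A, koszul_d z A = 0) -> span_lt s (z set0) ->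
  exists y, forall A, koszul_d y A = z A.
Proof.
move=> dz z0; have [|//|//|y _ ?] := @koszul_d_exact_lt s z (leqnn s).
  by move=> A j _; rewrite leqNgt ltn_ord.
by exists y.
Qed.

End KoszulDifferential.

(** * The Koszul complex of a regular sequence as a based complex *)

Section KoszulComplex.

Variables (n : nat) (k : fieldType) (s : nat) (f : 'I_s -> {mpoly k[n]}).

Lemma ideal_genP (P : pred 'I_s) (S : {mpoly k[n]} -> Prop) r :
    (forall g, S g <-> exists2 j, P j & g = f j) ->
  ideal_gen S r <->
  exists a : 'I_s -> {mpoly k[n]}, r = \sum_(j | P j) a j * f j.
Proof.
move=> SP; split=> [[l Sl ->]|[a ->]]; last first.
  exists [seq (a j, f j) | j <- enum P].
    by move=> p /mapP[j]; rewrite mem_enum => Pj ->; apply/SP; exists j.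
  by rewrite big_map big_enum.
elim: l Sl => [|p l IHl] Sl.
  by exists (fun=> 0); rewrite big_nil big1 // => j _; rewrite mul0r.
have [|a aE] := IHl; first by move=> q ql; apply: Sl; rewrite inE ql orbT.
have /SP[j Pj pj] := Sl p (mem_head p l).
exists (fun i => a i + (if i == j then p.1 else 0)); rewrite big_cons aE pj.
rewrite addrC.
under [RHS]eq_bigr do rewrite mulrDl.
rewrite big_split /=; congr (_ + _).
rewrite (bigD1 j) //= eqxx big1 ?addr0 // => i /andP[_ ij].
by rewrite (negbTE ij) mul0r.
Qed.

Lemma ideal_of_ltP (i : 'I_s) r : ideal_of_lt f i r <-> span_lt f i r.
Proof. exact: ideal_genP. Qed.

Lemma ideal_ofP r : ideal_of f r <-> span_lt f s r.
Proof.
apply: ideal_genP => g; split=> [[j ->]|[j _ ->]]; exists j => //.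
Qed.

Definition koszul_index t (A : {set 'I_s}) (At : #|A| == t) :
  koszul_basis s t := Sub A At.

Lemma val_koszul_index t (A : {set 'I_s}) (At : #|A| == t) :
  val (koszul_index At) = A.
Proof. exact: SubK. Qed.

Section Extension.

Variable t : nat.
Implicit Type h : freemod n k (koszul_basis s t).

(** Extension by zero from subsets of size [t] to all subsets, linking the graded complex to
    [koszul_d]. *)
Definition koszul_ext h (A : {set 'I_s}) : {mpoly k[n]} :=
  if insub A is Some J then fcoord h J else 0.

Lemma koszul_ext_val h (J : koszul_basis s t) :
  koszul_ext h (val J) = fcoord h J.
Proof. by rewrite /koszul_ext valK. Qed.

Lemma koszul_ext_out h (A : {set 'I_s}) : #|A| != t -> koszul_ext h A = 0.
Proof. by move=> At; rewrite /koszul_ext insubN. Qed.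

Lemma koszul_extE h (A : {set 'I_s}) (At : #|A| == t) :
  koszul_ext h A = fcoord h (koszul_index At).
Proof. by rewrite -koszul_ext_val val_koszul_index. Qed.

End Extension.

(** For given [J'] and [j], only J = J' ∪ {j} contributes, and [j] has the same number of
    predecessors in both sets. *)
Lemma koszul_bdE t (h : freemod n k (koszul_basis s t.+1))
    (J' : koszul_basis s t) :
  fcoord (lin_ext (@koszul_bd n k s f t) h) J'
    = koszul_d f (koszul_ext h) (val J').
Proof.
rewrite /lin_ext fcoord_sum.
transitivity (\sum_(J : koszul_basis s t.+1)
   \sum_(j in val J | val J' == val J :\ j)
   fcoord h J * ((-1) ^+ #|[set l in val J | (l < j)%N]| * f j)).
  by apply: eq_bigr => J _; rewrite fcoordZ {2}/fcoord ffunE mulr_sumr.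
rewrite (exchange_big_dep (fun j => j \notin val J')) /=; last first.
  by move=> J j _ /andP[_ /eqP ->]; rewrite setD11.
apply: eq_bigr => j jJ'.
have cardJ : #|j |: val J'| == t.+1 by rewrite cardsU1 jJ' (eqP (valP J')).
rewrite (big_pred1 (koszul_index cardJ)) => [|J].
  rewrite (koszul_extE h cardJ) mulrC; congr (_ ^+ _ * _ * _).
  apply: eq_card => l; rewrite val_koszul_index !inE.
  by case: eqVneq => [->|//]; rewrite ltnn !andbF.
rewrite [RHS](_ : _ = (val J == j |: val J')) //.
apply/andP/eqP => [[jJ /eqP EJ]|EJ].
  by apply: etrans (esym (setD1K jJ)) _; congr (_ |: _); apply: esym EJ.
by rewrite EJ setU11 setU1K.
Qed.

Lemma koszul_ext_bd t (h : freemod n k (koszul_basis s t.+1)) A :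
  koszul_ext (lin_ext (@koszul_bd n k s f t) h) A = koszul_d f (koszul_ext h) A.
Proof.
have [At|At] := boolP (#|A| == t).
  by rewrite (koszul_extE _ At) koszul_bdE val_koszul_index.
rewrite koszul_ext_out // /koszul_d big1 // => j jA.
by rewrite koszul_ext_out ?mulr0 // cardsU1 jA.
Qed.

Lemma koszul_bdK t (h : freemod n k (koszul_basis s t.+2)) :
  lin_ext (@koszul_bd n k s f t) (lin_ext (@koszul_bd n k s f t.+1) h) = 0.
Proof.
apply: freemodP => J; rewrite koszul_bdE fcoord0.
rewrite -[RHS](koszul_dK f (koszul_ext h) (val J)).
by apply: eq_bigr => j _; rewrite koszul_ext_bd.
Qed.

Hypothesis hreg : regular_sequence f.

(** The bounding chain may involve subsets of every size; its part of size [t.+1] suffices. *)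
Lemma koszul_bd_exact t (h : freemod n k (koszul_basis s t)) :
    (forall A, koszul_d f (koszul_ext h) A = 0) ->
    ideal_of f (koszul_ext h set0) ->
  exists h', h = lin_ext (@koszul_bd n k s f t) h'.
Proof.
move=> dh /ideal_ofP h0.
have reg (r : 'I_s) c : span_lt f r (f r * c) -> span_lt f r c.
  by move/ideal_of_ltP/hreg.1/ideal_of_ltP.
have [y dy] := koszul_d_exact reg dh h0.
exists [ffun J : koszul_basis s t.+1 => (y (val J) : {mpoly k[n]}^o)].
apply: freemodP => J; rewrite koszul_bdE -koszul_ext_val -dy.
apply: eq_bigr => j jJ.
have cardJ : #|j |: val J| == t.+1 by rewrite cardsU1 jJ (eqP (valP J)).
by rewrite (koszul_extE _ cardJ) /fcoord ffunE val_koszul_index.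
Qed.

(** If [f i] were 0, regularity would put 1 in the ideal of the earlier elements. *)
Lemma regular_sequence_neq0 i : f i != 0.
Proof.
apply/eqP => fi0; have [reg not1] := hreg; apply: not1.
have /ideal_of_ltP[a a1] : ideal_of_lt f i 1.
  by apply: reg; rewrite fi0 mul0r; exists [::]; rewrite ?big_nil.
exists [seq (a j, f j) | j : 'I_s <- enum 'I_s & (j < i)%N].
  by move=> p /mapP[j _ ->]; exists j.
by rewrite big_map big_filter big_enum_cond.
Qed.

Variables (L : zmodClosed 'rV[int]_n) (b : 'I_s -> degree L).
Hypothesis hL : pointed_lattice L.
Hypothesis hdeg : forall i, homog_poly (b i) (f i).

(** A nonzero constant term forces degree 0, so [f i] would be a nonzero constant and generate the
    unit ideal. *)
Lemma regular_sequence_coef0 i : (f i)@_0%MM = 0.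
Proof.
apply/eqP; apply: contraT => fi0.
have bi0 : b i = 0 by rewrite -(hdeg (m := 0%MM)) ?mcoeff_msupp // mdegA0.
have fiC : f i = ((f i)@_0%MM)%:MP.
  by apply: (homog_poly0 hL); rewrite -bi0; apply: hdeg.
case: hreg => _ []; exists [:: (((f i)@_0%MM)^-1%:MP, f i)].
  by move=> p; rewrite inE => /eqP->; exists i.
by rewrite big_seq1 /= [X in _ * X]fiC -mpolyCM mulVf.
Qed.

Lemma koszul_degU1 t (J : koszul_basis s t.+1) (A : {set 'I_s}) j :
  j \notin A -> val J = j |: A -> koszul_deg b J = b j + \sum_(i in A) b i.
Proof. by move=> jA JA; rewrite /koszul_deg JA big_setU1. Qed.

Lemma koszul_based_complex : based_complex (koszul f b).
Proof.
split=> [i E|i a h hh J m|i h]; last exact: koszul_bdK.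
  rewrite /= /koszul_deg; elim/big_rec: _ => [|j x _ [m ->]].
    by exists 0%MM; rewrite mdegA0.
  (* Any monomial of the nonzero [f j] shows that [b j] lies in the semigroup. *)
  have [m' m'f] : exists m', m' \in msupp (f j).
    have := regular_sequence_neq0 j; rewrite -msupp_eq0.
    by case: (msupp _) => // m' l _; exists m'; rewrite mem_head.
  by exists (m' + m)%MM; rewrite mdegAD (hdeg m'f).
rewrite [fcoord _ _]koszul_bdE mcoeff_msupp raddf_sum => sum_n0.
have [j jJ] : exists2 j, j \notin val J
    & m \in msupp (f j * koszul_ext h (j |: val J)).
  apply/exists_inP; apply: contraNT sum_n0 => /exists_inPn noj.
  rewrite big1 // => j /noj; rewrite -mcoeff_eq0 => /eqP c0 /=.
  by rewrite -mulrA -signr_odd mulr_sign; case: odd; rewrite ?mcoeffN c0 ?oppr0.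
move/msuppM_le/allpairsP=> [[m1 m2] /= [m1f m2h ->]].
have cardJ : #|j |: val J| == i.+1 by rewrite cardsU1 jJ (eqP (valP J)).
rewrite (koszul_extE h cardJ) in m2h.
rewrite -(hh _ _ m2h) mdegAD (hdeg m1f) /=.
rewrite (koszul_degU1 jJ (val_koszul_index cardJ)) /koszul_deg addrCA.
by rewrite addrA.
Qed.

Lemma koszul_starts_with_one : starts_with_one (koszul f b).
Proof.
have c0 : #|set0 : {set 'I_s}| == 0%N by rewrite cards0.
split=> [|E].
  apply/eqP/fintype1P; exists (koszul_index c0) => E; apply: val_inj.
  rewrite val_koszul_index.
  by apply/eqP; rewrite -cards_eq0 (valP E).
rewrite /= /koszul_deg big_pred0 // => j.
by have /eqP/cards0_eq -> := valP E; rewrite inE.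
Qed.

Lemma koszul_minimal : minimal_diff (koszul f b).
Proof.
move=> i h J; rewrite [fcoord _ _]koszul_bdE raddf_sum big1 // => j _ /=.
by rewrite !rmorphM /= regular_sequence_coef0 mulr0 mul0r.
Qed.

Lemma koszul_exact (I : {mpoly k[n]} -> Prop) :
  (forall g, I g <-> ideal_of f g) -> exact_over I (koszul f b).
Proof.
have c0 : #|set0 : {set 'I_s}| == 0%N by rewrite cards0.
move=> hI [|i] h; split.
(* In degree 0 the extended chain lives on the empty set alone, so its [koszul_d] vanishes and only
   the ideal condition remains. *)
- case=> r /hI Ir hr; apply: koszul_bd_exact => [A|].
    rewrite /koszul_d big1 // => j jA.
    by rewrite koszul_ext_out ?mulr0 // cardsU1 jA.
  suff -> : koszul_ext h set0 = r by [].
  by rewrite (koszul_extE _ c0) hr; apply: fcoord_in0.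
- case=> h' hh'.
  have J0 (J : koszul_basis s 0) : J = koszul_index c0.
    by apply: val_inj; rewrite SubK; apply/cards0_eq/eqP/(valP J).
  exists (fcoord h (koszul_index c0)); last first.
    by apply: freemodP => J; rewrite fcoord_in0 (J0 J).
  apply/hI/ideal_ofP; rewrite hh' [fcoord _ _]koszul_bdE val_koszul_index.
  exists (fun j => (-1) ^+ rank_in set0 j * koszul_ext h' (j |: set0)).
  apply: eq_big => [j|j _]; first by rewrite inE ltn_ord.
  by rewrite mulrAC.
- move=> /ker_diffS dh; apply: koszul_bd_exact => [A|].
    by rewrite -koszul_ext_bd [lin_ext _ _]dh /koszul_ext; case: insub => // J;
      rewrite fcoord0.
  (* In positive degree the coordinate at the empty set is 0. *)
  by rewrite koszul_ext_out ?cards0 //; exists [::]; rewrite ?big_nil.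
- by case=> h' ->; apply/ker_diffS/koszul_bdK.
Qed.

Hypothesis hinc : forall i j, i != j -> deg_incomparable (b i) (b j).

(** With J = E \ {j}, the coordinates of [h] that reach [J] sit at J ∪ {l}. For l = j it is the one
    at [E], zero by assumption; for l ≠ j a monomial in it would have degree b_j - b_l, making b_j ≥
    b_l. *)
Lemma koszul_isolated : isolated_basis (koszul f b).
Proof.
move=> i E h hh hE J.
rewrite [bdiff _ _ (bvec _ _ _)]lin_ext_bvec [fcoord _ _]ffunE => JE.
have [j jE /eqP EJ] : exists2 j, j \in val E & val J == val E :\ j.
  apply/exists_inP; apply: contraNT JE => /exists_inPn noj.
  by rewrite big1 // => j /andP[/noj/negbTE ->].
have jJ : j \notin val J by rewrite EJ setD11.
rewrite [fcoord _ _]koszul_bdE /koszul_d big1 // => l lJ.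
have cardJ : #|l |: val J| == i.+1 by rewrite cardsU1 lJ (eqP (valP J)).
suff -> : koszul_ext h (l |: val J) = 0 by rewrite mulr0.
have [lj|lj] := eqVneq l j.
  by rewrite lj EJ setD1K // koszul_ext_val.
rewrite (koszul_extE h cardJ); apply/eqP; rewrite -msupp_eq0.
case hm: (msupp _) => [//|m ms].
have mh : m \in msupp (fcoord h (koszul_index cardJ)).
  by rewrite hm mem_head.
have := hh _ _ mh.
have Ej : val E = j |: val J by rewrite EJ setD1K.
rewrite /= (koszul_degU1 lJ (val_koszul_index cardJ)) (koszul_degU1 jJ Ej).
rewrite addrA => /addIr mb.
case: (hinc lj) => _ []; exists (mdegA L m); split; first by exists m.
by rewrite -mb addrC.
Qed.

End KoszulComplex.

Theorem theorem4p4 (n : nat) (k : fieldType) (L : zmodClosed 'rV[int]_n)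
    (hL : pointed_lattice L)
    (s : nat) (f : 'I_s -> {mpoly k[n]}) (b : 'I_s -> degree L)
    (hI : forall g, lattice_ideal L g <-> ideal_of f g)
    (hbin : forall i, is_binomial (f i))
    (hreg : regular_sequence f)
    (hdeg : forall i, homog_poly (b i) (f i))
    (hinc : forall i j, i != j -> deg_incomparable (b i) (b j)) :
  indispensable_complex (lattice_ideal L) (koszul f b).
Proof.
apply: isolated_indispensable => //.
- exact: koszul_based_complex.
- exact: koszul_starts_with_one.
- exact: koszul_exact.
- exact: koszul_minimal.
- exact: koszul_isolated.
Qed.
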